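(* Let $q\in\mathbb{Z}_+^{\mathcal I}$ be an interior point and let $s\in\mathcal P$ be a schedule such that $r(q,s)=r_{\max}$. Then $s$ is an optimal schedule at $q$ in any value iteration; that is, for every $n\ge 0$, $s$ attains the maximum $$\max_{s'\in\mathcal P}\left\{ r(q,s')+\beta\,\mathbb{E}\big[V_n((q-s')^++A)\big]\right\}.$$
   Context: Let $\mathcal I=\{(i,j): i,j\in\{1,2\}\}$ index the four queues of a $2\times 2$ input-queued switch (queue $(i,j)$ is for input port $i$ and output port $j$). States are vectors $q=(q_\rho)_{\rho\in\mathcal I}\in\mathbb{Z}_+^{\mathcal I}\cong\mathbb{Z}_+^4$, $\mathbb{Z}_+=\{0,1,2,\dots\}$. A schedule is a vector $s=(s_\rho)_{\rho\in\mathcal I}\in\{0,1\}^{\mathcal I}$ with $\sum_j s_{(i,j)}\le 1$ for each $i$ and $\sum_i s_{(i,j)}\le 1$ for each $j$; $\mathcal P$ is the set of all schedules. The arrival vector $A=(A_\rho)_{\rho\in\mathcal I}$ takes values in $\mathbb{Z}_+^{\mathcal I}$, has independent coordinates, and its means $\lambda_\rho=\mathbb{E}[A_\rho]$ satisfy $\sum_i\lambda_{(i,j)}<1$ for each $j$ and $\sum_j\lambda_{(i,j)}<1$ for each $i$. Fix cost constants $c_\rho\ge 0$ ($\rho\in\mathcal I$) and $\beta\in(0,1)$. The reward is $r(q,s)=\sum_{\rho\in\mathcal I}c_\rho s_\rho\,\mathbb{I}_{\{q_\rho>0\}}$. Write $(x)^+$ for the componentwise maximum of $x$ and $0$. The value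 functions of value iteration are $V_0\equiv 0$ and $V_{n+1}(q)=\max_{s\in\mathcal P}\{r(q,s)+\beta\,\mathbb{E}[V_n((q-s)^++A)]\}$ for $n\ge 0$. Let $r_{\max}=\max\{r(q,s): q\in\mathbb{Z}_+^{\mathcal I},\ s\in\mathcal P\}$. A state $q$ is an interior point if $\max\{r(q,s): s\in\mathcal P\}=r_{\max}$. *)

(* Defs.v *)
From mathcomp Require Export all_boot all_order all_algebra.
From mathcomp Require Export all_classical all_reals all_analysis.
Set Implicit Arguments.
Unset Strict Implicit.
Unset Printing Implicit Defensive.
Import Order.TTheory GRing.Theory Num.Theory.
Local Open Scope classical_set_scope.
Local Open Scope ring_scope.

(* Queue (i, j) joins input port i to output port j; ports are numbered from 0. *)
Notation queue := ('I_2 * 'I_2)%type.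

Notation state := {ffun queue -> nat}.

(* 0/1 vectors are boolean vectors, with the coercion bool >-> nat. *)
Notation bvec := {ffun queue -> bool}.

Definition schedules : {set bvec} :=
  [set s : bvec |
     [forall i : 'I_2, (\sum_(j < 2) s (i, j) <= 1)%N] &&
     [forall j : 'I_2, (\sum_(i < 2) s (i, j) <= 1)%N]]%SET.

Definition idle : bvec := [ffun _ => false].

Lemma idle_schedule : idle \in schedules.
Proof.
by rewrite inE; apply/andP; split; apply/forallP => i;
   rewrite big1 // => j _; rewrite ffunE.
Qed.

(* max_{s in schedules} f s. By idle_schedule, the starting value f idle is one
   of the values being compared, so that it does not affect the maximum. *)
Definition sched_max (R : realType) (f : bvec -> R) : R :=
  \big[Num.max/f idle]_(s in schedules) f s.

Definition reward (R : realType) (c : queue -> R) (q : state) (s : bvec) : R :=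
  \sum_(rho : queue) c rho * (s rho)%:R * (0 < q rho)%N%:R.

(* The maximum over all states and schedules. It is a supremum over an infinite
   index set, and it is attained: see r_max_attained. *)
Definition r_max (R : realType) (c : queue -> R) : R :=
  sup [set x : R | exists (q : state) (s : bvec),
                     s \in schedules /\ x = reward c q s].

Definition interior_point (R : realType) (c : queue -> R) (q : state) : Prop :=
  sched_max (reward c q) = r_max c.

(* (q - s)^+ + a, where the subtraction of nat is truncated at 0. *)
Definition next_state (q : state) (s : bvec) (a : state) : state :=
  [ffun rho => (q rho - s rho + a rho)%N].

(* r(q, s) + beta E[V((q - s)^+ + A)]. The map fine only drops the extended
   real wrapper: it is used with bounded V, whose expectation is finite. *)
Definition action_value (R : realType) (d : measure_display)
    (T : measurableType d) (P : probability T R) (A : T -> state)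
    (c : queue -> R) (beta : R) (V : state -> R) (q : state) (s : bvec) : R :=
  reward c q s + beta * fine ('E_P[fun w => V (next_state q s (A w))])%E.

Fixpoint value (R : realType) (d : measure_display)
    (T : measurableType d) (P : probability T R) (A : T -> state)
    (c : queue -> R) (beta : R) (n : nat) (q : state) : R :=
  if n is m.+1
  then sched_max (action_value P A c beta (value P A c beta m) q)
  else 0.

(* Mutual independence of the coordinates: the product rule holds for every
   subfamily J of coordinates. *)
Definition independent_coordinates (R : realType) (d : measure_display)
    (T : measurableType d) (P : probability T R) (A : T -> state) : Prop :=
  forall (J : {set queue}) (B : queue -> set nat),
    P [set w | forall rho : queue, rho \in J -> B rho (A w rho)] =
    (\prod_(rho in J) P [set w | B rho (A w rho)])%E.

(* The mean of a coordinate of A, as an extended real: it may be +oo a priori. *)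
Definition mean_arrivals (R : realType) (d : measure_display)
    (T : measurableType d) (P : probability T R) (A : T -> state)
    (rho : queue) : \bar R :=
  ('E_P[fun w => (A w rho)%:R : R])%E.

Lemma le_sched_max (R : realType) (f : bvec -> R) (s : bvec) :
  s \in schedules -> f s <= sched_max f.
Proof. by move=> sS; rewrite /sched_max (bigD1 s) //= le_max lexx. Qed.

Lemma sched_max_attained (R : realType) (f : bvec -> R) :
  exists2 s : bvec, s \in schedules & sched_max f = f s.
Proof.
rewrite /sched_max; elim/big_ind: _.
- by exists idle => //; exact: idle_schedule.
- move=> _ _ [s sS ->] [t tS ->].
  by case: (leP (f s) (f t)) => _; [exists t | exists s].
- by move=> s sS; exists s.
Qed.

Lemma r_max_attained (R : realType) (c : queue -> R) :
  (forall rho, 0 <= c rho) ->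
  (exists q : state, exists2 s : bvec,
      s \in schedules & r_max c = reward c q s) /\
  (forall (q : state) (s : bvec), s \in schedules -> reward c q s <= r_max c).
Proof.
move=> c0; pose q1 : state := [ffun _ => 1%N].
have ub q s : s \in schedules -> reward c q s <= sched_max (reward c q1).
  move=> sS; apply: le_trans (le_sched_max (reward c q1) sS).
  apply: ler_sum => rho _; rewrite ffunE mulr1.
  by case: (0 < q rho)%N; rewrite ?mulr1 // mulr0 mulr_ge0.
have [s1 s1S E1] := sched_max_attained (reward c q1).
have rE : r_max c = sched_max (reward c q1).
  apply/eqP; rewrite eq_le; apply/andP; split.
    apply: ge_sup; first by exists (reward c q1 s1), q1, s1.
    by move=> _ [q [s [sS ->]]]; exact: ub.
  apply: ub_le_sup; last by exists q1, s1; split.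
  by exists (sched_max (reward c q1)) => _ [q [s [sS ->]]]; exact: ub.
split; first by exists q1, s1; rewrite // rE.
by move=> q s sS; rewrite rE; exact: ub.
Qed.

(* Main.v *)
Require Import Defs.
From mathcomp Require Import all_boot all_order all_algebra.
From mathcomp Require Import all_classical all_reals all_analysis.
From mathcomp Require Import lra zify.
Import Order.TTheory GRing.Theory Num.Theory.
Local Open Scope classical_set_scope.
Local Open Scope ring_scope.
Set Implicit Arguments.
Unset Strict Implicit.
Unset Printing Implicit Defensive.

(** Write [weight c s] for the total cost of the queues that [s] serves, and
    call [s] heavy if it is a schedule of weight [r_max c].

    The proof compares the expected values of the states reached by [s] and by a
    competitor [t], both restricted to the nonempty queues, which makes [s] heavy.
    Relative to the jobs that neither of them serves, [s] leaves the jobs of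
    [t \ s] behind, and [t] those of [s \ t].  What is needed is that the second
    collection of jobs be worth at most [weight c s - weight c t] more than the
    first: then the immediate gain of [s] outweighs the discounted loss.

    Two facts about the value functions give this.  First, a set of additional
    jobs is worth something between [0] and its weight ([value_add_jobs], by
    imitation).  Secondly, replacing a heavy [s] by a schedule [t] in a set of
    waiting jobs loses at most [weight c s - weight c t] ([value_swap_bound]).

    If [s] and [t] are disjoint, the second fact is exactly what is needed.  If
    they share a queue, then in a 2 x 2 switch their union is still a schedule
    ([meeting_schedules_union]); since [s] is heavy, [t \ s] has weight zero, and
    the first fact suffices ([swap_diff]).

    The swap bound and the optimality of heavy schedules are proved together.
    The swap bound after [n] steps yields optimality for the next step
    ([optimal_of_swap_bound]).  By optimality, it is best to serve [s] where the
    jobs of [s] are waiting; where those of [t] are waiting, [t] may be served.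
    Both reach the same state, after earning [weight c s] and [weight c t].  This
    is the swap bound after [n + 1] steps. *)

(** * Schedules and rewards *)

Definition add_jobs (x : state) (u : bvec) : state :=
  [ffun rho => (x rho + u rho)%N].

Definition unionb (s t : bvec) : bvec := [ffun rho => s rho || t rho].
Definition diffb (s t : bvec) : bvec := [ffun rho => s rho && ~~ t rho].
Definition active (q : state) (s : bvec) : bvec :=
  [ffun rho => s rho && (0 < q rho)%N].

Definition weight (R : realType) (c : queue -> R) (s : bvec) : R :=
  \sum_(rho : queue) c rho * (s rho)%:R.

Lemma subschedule (s t : bvec) :
  s \in schedules -> (forall rho, t rho -> s rho) -> t \in schedules.
Proof.
rewrite !inE => /andP[/forallP sr /forallP sc] ts.
apply/andP; split; apply/forallP => i; [move: (sr i)|move: (sc i)];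
  apply: leq_trans; apply: leq_sum => j _.
  by move: (ts (i, j)); case: (t _) => // ->.
by move: (ts (j, i)); case: (t _) => // ->.
Qed.

Lemma active_schedule (q : state) (s : bvec) :
  s \in schedules -> active q s \in schedules.
Proof. by move=> /subschedule; apply => rho; rewrite ffunE => /andP[]. Qed.

(** Two ports on each side are essential here: a schedule that serves [(i, j)]
    can serve besides only the opposite queue, so two schedules that share a
    queue are both contained in one perfect matching. *)
Lemma meeting_schedules_union (s t : bvec) (rho : queue) :
  s \in schedules -> t \in schedules -> s rho -> t rho ->
  unionb s t \in schedules.
Proof.
have ord2 (i : 'I_2) : i = ord0 \/ i = lift ord0 ord0.
  by case: (unliftP ord0 i) => [k ->|->]; [right; rewrite (ord1 k)|left].
rewrite !inE => /andP[/forallP sr /forallP sc] /andP[/forallP tr /forallP tc].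
have := (sr ord0, sr (lift ord0 ord0), sc ord0, sc (lift ord0 ord0)).
have := (tr ord0, tr (lift ord0 ord0), tc ord0, tc (lift ord0 ord0)).
rewrite !big_ord_recl !big_ord0 => -[[[t1 t2] t3] t4] [[[s1 s2] s3] s4] srho trho.
suff H : [/\ (unionb s t (ord0, ord0) + unionb s t (ord0, lift ord0 ord0) <= 1)%N,
  (unionb s t (lift ord0 ord0, ord0)
    + unionb s t (lift ord0 ord0, lift ord0 ord0) <= 1)%N,
  (unionb s t (ord0, ord0) + unionb s t (lift ord0 ord0, ord0) <= 1)%N &
  (unionb s t (ord0, lift ord0 ord0)
    + unionb s t (lift ord0 ord0, lift ord0 ord0) <= 1)%N].
  case: H => u1 u2 u3 u4.
  by apply/andP; split; apply/forallP => i; rewrite !big_ord_recl big_ord0 addn0;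
     case: (ord2 i) => ->.
move: rho srho trho t1 t2 t3 t4 s1 s2 s3 s4; rewrite !ffunE => -[i j].
by case: (ord2 i) => ->; case: (ord2 j) => ->;
   case: (s (ord0, ord0)); case: (s (ord0, lift ord0 ord0));
   case: (s (lift ord0 ord0, ord0)); case: (s (lift ord0 ord0, lift ord0 ord0));
   case: (t (ord0, ord0)); case: (t (ord0, lift ord0 ord0));
   case: (t (lift ord0 ord0, ord0)); case: (t (lift ord0 ord0, lift ord0 ord0)).
Qed.

(** A service offered to an empty queue neither earns a reward nor changes the
    state, so a schedule may be replaced by its active part. *)
Lemma next_state_active (q : state) (s : bvec) (a : state) :
  next_state q (active q s) a = next_state q s a.
Proof.
by apply/ffunP => rho; rewrite !ffunE; case: (q rho) => [|n] /=;
   case: (s rho).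
Qed.

(** Jobs added before service are still there afterwards, except those that
    fill a queue which would have been served while empty. *)
Lemma next_state_add_jobs (q : state) (u s : bvec) (a : state) :
  next_state (add_jobs q u) s a =
  add_jobs (next_state q s a) (diffb u (diffb s (active q s))).
Proof.
apply/ffunP => rho; rewrite !ffunE.
by case: (q rho) => [|n]; case: (s rho); case: (u rho) => /=; lia.
Qed.

(** The state reached does not depend on [s]: the swap bound relies on it. *)
Lemma next_state_served (x : state) (s a : _) :
  next_state (add_jobs x s) s a = [ffun rho => (x rho + a rho)%N].
Proof. by apply/ffunP => rho; rewrite !ffunE addnK. Qed.

Section Rewards.
Context {R : realType} (c : queue -> R).
Hypothesis c_ge0 : forall rho, 0 <= c rho.

Lemma reward_active (q : state) (s : bvec) : reward c q s = weight c (active q s).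
Proof.
by apply: eq_bigr => rho _; rewrite ffunE -mulrA -natrM mulnb.
Qed.

Lemma weight_ge0 (s : bvec) : 0 <= weight c s.
Proof. by apply: sumr_ge0 => rho _; rewrite mulr_ge0. Qed.

Lemma weight_diff (s t : bvec) :
  weight c (diffb s t) = weight c (unionb s t) - weight c t.
Proof.
rewrite -sumrB; apply: eq_bigr => rho _; rewrite !ffunE.
by case: (s rho); case: (t rho); rewrite /= ?mulr0 ?mulr1 ?subrr ?subr0.
Qed.

(** Additional jobs raise the immediate reward exactly where they fill a queue
    that would have been served while empty. *)
Lemma reward_add_jobs (q : state) (u s : bvec) :
  reward c (add_jobs q u) s =
  reward c q s + weight c u - weight c (diffb u (diffb s (active q s))).
Proof.
rewrite -big_split -sumrB; apply: eq_bigr => rho _; rewrite !ffunE /=.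
by case: (q rho) => [|n]; case: (s rho); case: (u rho);
   rewrite /= ?mulr0 ?mulr1; lra.
Qed.

Lemma weight_le_r_max (s : bvec) : s \in schedules -> weight c s <= r_max c.
Proof.
move=> sS; have [_ /(_ [ffun=> 1%N] s sS)] := r_max_attained c_ge0.
rewrite reward_active; congr (weight c _ <= _).
by apply/ffunP => rho; rewrite !ffunE andbT.
Qed.

(** If [s] has maximal weight and meets [t], then their union is a schedule, so
    what [t] adds to [s] is worthless. *)
Lemma weight_diff_meeting (s t : bvec) (rho : queue) :
  s \in schedules -> t \in schedules -> weight c s = r_max c ->
  s rho -> t rho -> weight c (diffb t s) = 0.
Proof.
move=> sS tS smax srho trho; apply/eqP; rewrite eq_le weight_ge0 andbT.
rewrite weight_diff smax subr_le0; apply: weight_le_r_max.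
exact: (meeting_schedules_union (rho := rho)).
Qed.

End Rewards.

(** * Expectations of bounded functions of the arrivals *)

Definition bounded_on_states (R : realType) (V : state -> R) : Prop :=
  exists M : R, forall q, `|V q| <= M.

Section Expectation.
Context {R : realType} {d : measure_display} {T : measurableType d}
  (P : probability T R) (A : T -> state).
Hypothesis mA : forall rho : queue, measurable_fun setT (fun w : T => A w rho).

(** There are only countably many states, so every function of the arrival
    vector is measurable. *)
Lemma measurable_arrivals (f : state -> R) :
  measurable_fun setT (fun w => f (A w)).
Proof.
have mA1 (a : state) : measurable [set w | A w = a].
  rewrite (_ : mkset _ = \bigcap_(rho in [set: queue]) [set w | A w rho = a rho]).
    apply: fin_bigcap_measurable => [|rho _]; first exact: finite_finset.
    by have /(_ [set a rho] Logic.I) := mA rho measurableT; rewrite setTI.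
  apply/seteqP; split => [w /= <- //|w /= H].
  by apply/ffunP => rho; exact: H.
move=> _ Y _; rewrite setTI.
rewrite (_ : _ @^-1` _ =
    \bigcup_(a : state) (if f a \in Y then [set w | A w = a] else set0)).
  apply: countable_bigcupT_measurable => [|a]; first exact: countableP.
  by case: ifP => _; [exact: mA1|exact: measurable0].
apply/seteqP; split => [w /= Yw|w [a _]].
  by exists (A w) => //; rewrite ifT // inE.
by case: ifPn => // /set_mem Ya /= ->.
Qed.

Lemma integrable_arrivals (f : state -> R) :
  bounded_on_states f -> P.-integrable setT (EFin \o (fun w => f (A w))).
Proof.
move=> [M fM]; apply: measurable_bounded_integrable => //.
- exact: le_lt_trans (probability_le1 P measurableT) (ltry 1).
- exact: measurable_arrivals.
- by exists M; split; [exact: num_real|move=> N MN w _; apply: le_trans (fM _) (ltW MN)].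
Qed.

Lemma expectation_le_add (f g : state -> R) (k : R) :
  bounded_on_states f -> bounded_on_states g -> (forall a, f a <= g a + k) ->
  fine ('E_P[fun w => f (A w)])%E <= fine ('E_P[fun w => g (A w)])%E + k.
Proof.
move=> bf bg fg; rewrite unlock.
have bk : bounded_on_states (fun _ : state => k) by exists `|k|.
have -> : k = \int[P]_(w in setT) k.
  by rewrite Rintegral_cst // [X in fine X](probability_setT P) mulr1.
rewrite -[fine (integral P _ (fun w => (g _)%:E))]/(\int[P]_w g (A w)).
rewrite -[fine _]/(\int[P]_w f (A w)) -RintegralD //.
- apply: le_Rintegral => //; first exact: integrable_arrivals.
  apply: (integrable_arrivals (f := fun a => g a + k)).
  case: bg => M gM; exists (M + `|k|) => a.
  by apply: le_trans (ler_normD _ _) _; rewrite lerD2r.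
- exact: integrable_arrivals.
- exact: (integrable_arrivals bk).
Qed.

Lemma expectation_bounded (f : state -> R) (M : R) :
  (forall a, `|f a| <= M) -> `|fine ('E_P[fun w => f (A w)])%E| <= M.
Proof.
move=> fM; have bf : bounded_on_states f by exists M.
have b0 : bounded_on_states (fun _ => 0 : R) by exists 0 => _; rewrite normr0.
have E0 : fine ('E_P[fun=> 0%R])%E = 0 by rewrite expectation_cst.
rewrite ler_norml; apply/andP; split.
  rewrite lerNl -subr_ge0 opprK addrC -[leLHS]E0.
  apply: (expectation_le_add b0 bf) => a.
  by have := fM a; rewrite ler_norml => /andP[]; lra.
rewrite -[leRHS]add0r -[X in X + _]E0.
apply: (expectation_le_add bf b0) => a.
by have := fM a; rewrite ler_norml => /andP[]; lra.
Qed.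

End Expectation.

(** * Value iteration *)

Section ValueIteration.
Context {R : realType} {d : measure_display} {T : measurableType d}
  (P : probability T R) (A : T -> state) (c : queue -> R) (beta : R).
Hypothesis mA : forall rho : queue, measurable_fun setT (fun w : T => A w rho).
Hypothesis c_ge0 : forall rho, 0 <= c rho.
Hypothesis beta_gt0 : 0 < beta.
Hypothesis beta_lt1 : beta < 1.

Let V := value P A c beta.
Let Q (n : nat) := action_value P A c beta (V n).
Let EV (n : nat) (q : state) (s : bvec) : R :=
  fine ('E_P[fun w => V n (next_state q s (A w))])%E.

Let valueS (n : nat) (q : state) : V n.+1 q = sched_max (Q n q).
Proof. by []. Qed.

Let QE (n : nat) (q : state) (s : bvec) :
  Q n q s = reward c q s + beta * EV n q s.
Proof. by []. Qed.

Lemma value_bounded (n : nat) : bounded_on_states (V n).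
Proof.
elim: n => [|n [M VM]]; first by exists 0 => q; rewrite normr0.
exists (r_max c + M) => q; rewrite valueS.
have [s sS ->] := sched_max_attained (Q n q).
have : `|beta * EV n q s| <= M.
  rewrite normrM gtr0_norm //; apply: le_trans (ler_piMl _ (ltW beta_lt1)) _ => //.
  by apply: (expectation_bounded P mA (f := fun a => V n (next_state q s a))).
rewrite ler_norml => /andP[lE uE].
have r0 : 0 <= reward c q s by rewrite reward_active weight_ge0.
have rm : reward c q s <= r_max c.
  by rewrite reward_active weight_le_r_max // active_schedule.
by rewrite ler_norml QE; apply/andP; split; lra.
Qed.

Lemma discounted_le (a b k : R) :
  0 <= k -> a <= b + k -> beta * a <= beta * b + k.
Proof.
move=> k0 ab; apply: (@le_trans _ _ (beta * (b + k))); first by rewrite ler_pM2l.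
by rewrite mulrDr lerD2l; apply: ler_piMl => //; exact: ltW.
Qed.

Lemma expected_value_le (n : nat) (x y : state) (s t : bvec) (k : R) :
  (forall a, V n (next_state x s a) <= V n (next_state y t a) + k) ->
  EV n x s <= EV n y t + k.
Proof.
have [M VM] := value_bounded n.
by apply: expectation_le_add; [exact: mA|exists M|exists M].
Qed.

(** Additional jobs [u] cannot hurt, as they may be ignored.  They earn at most
    [weight c u]: the smaller system can imitate the larger one until the
    latter serves an additional job, at which moment the two systems become one
    job closer.  In one step, the additional jobs split into those that
    fill a queue served while empty, which are paid at once, and the others,
    which are still there one step later. *)
Lemma value_add_jobs (n : nat) (x : state) (u : bvec) :
  V n x <= V n (add_jobs x u) <= V n x + weight c u.
Proof.
elim: n x u => [|n IH] x u; first by rewrite /= add0r lexx weight_ge0.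
have step s : [/\ EV n x s <= EV n (add_jobs x u) s + 0,
    EV n (add_jobs x u) s <=
      EV n x s + weight c (diffb u (diffb s (active x s))) &
    0 <= weight c (diffb u (diffb s (active x s))) <= weight c u].
  split.
  - apply: expected_value_le => a.
    by rewrite addr0 next_state_add_jobs; case/andP: (IH (next_state x s a)
      (diffb u (diffb s (active x s)))).
  - apply: expected_value_le => a.
    by rewrite next_state_add_jobs; case/andP: (IH (next_state x s a)
      (diffb u (diffb s (active x s)))).
  - rewrite weight_ge0 //=; apply: ler_sum => rho _; rewrite !ffunE.
    by apply: ler_wpM2l => //; rewrite ler_nat; case: (u rho) => //=; case: (~~ _).
rewrite !valueS; apply/andP; split.
- have [s sS ->] := sched_max_attained (Q n x).
  apply: le_trans (le_sched_max (Q n (add_jobs x u)) sS).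
  have [/(discounted_le (lexx 0)) lo _ /andP[_ wu]] := step s.
  by rewrite !QE reward_add_jobs; lra.
- have [s sS ->] := sched_max_attained (Q n (add_jobs x u)).
  apply: le_trans (lerD (le_sched_max (Q n x) sS) (lexx _)).
  have [_ hi /andP[/discounted_le/(_ hi) {}hi _]] := step s.
  by rewrite !QE reward_add_jobs; lra.
Qed.

(** This is the induction hypothesis of the whole argument; both sides are
    arranged as sums to avoid subtractions. *)
Definition swap_bound (n : nat) : Prop :=
  forall (x : state) (s t : bvec), s \in schedules -> t \in schedules ->
    weight c s = r_max c ->
    V n (add_jobs x s) + weight c t <= V n (add_jobs x t) + weight c s.

(** The swap bound for the jobs that distinguish the states after serving [s] and
    after serving [t]. These differ from [s] and [t] themselves only if the two
    schedules meet. *)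
Lemma swap_diff (n : nat) (x : state) (s t : bvec) :
  swap_bound n -> s \in schedules -> t \in schedules ->
  weight c s = r_max c ->
  V n (add_jobs x (diffb s t)) + weight c t
    <= V n (add_jobs x (diffb t s)) + weight c s.
Proof.
move=> swap sS tS smax.
have [/existsP[rho /andP[srho trho]]|] := boolP [exists rho, s rho && t rho].
  have wts := weight_diff_meeting c_ge0 sS tS smax srho trho.
  have /andP[lo _] := value_add_jobs n x (diffb t s).
  have /andP[_ hi] := value_add_jobs n x (diffb s t).
  have wst : weight c (diffb s t) = weight c s - weight c t.
    rewrite weight_diff; move: wts; rewrite weight_diff.
    rewrite (_ : unionb s t = unionb t s); first by lra.
    by apply/ffunP => sigma; rewrite !ffunE orbC.
  lra.
rewrite negb_exists => /forallP dst.
have -> : diffb s t = s.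
  by apply/ffunP => rho; rewrite ffunE; move: (dst rho); case: (s rho); case: (t rho).
have -> : diffb t s = t.
  by apply/ffunP => rho; rewrite ffunE; move: (dst rho); case: (s rho); case: (t rho).
exact: swap.
Qed.

(** The gain of [s] over [t] is earned now and the swap bound limits the loss
    that is felt only later, hence discounted, to the same amount. *)
Lemma optimal_of_swap_bound (n : nat) (q : state) (s t : bvec) :
  swap_bound n -> s \in schedules -> t \in schedules ->
  reward c q s = r_max c -> Q n q t <= Q n q s.
Proof.
move=> swap sS tS; rewrite !QE !reward_active.
set s' := active q s; set t' := active q t => smax.
have s'S : s' \in schedules by exact: active_schedule.
have t'S : t' \in schedules by exact: active_schedule.
have tmax : weight c t' <= weight c s' by rewrite smax weight_le_r_max.
suff /discounted_le : EV n q t <= EV n q s + (weight c s' - weight c t').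
  by rewrite subr_ge0 => /(_ tmax); lra.
apply: expected_value_le => a.
(* The jobs that neither [s] nor [t] serves, together with the arrivals. *)
pose z : state := [ffun rho => (q rho - unionb s' t' rho + a rho)%N].
have -> : next_state q t a = add_jobs z (diffb s' t').
  apply/ffunP => rho; rewrite !ffunE.
  by case: (q rho) => [|m]; case: (s rho); case: (t rho) => /=; lia.
have -> : next_state q s a = add_jobs z (diffb t' s').
  apply/ffunP => rho; rewrite !ffunE.
  by case: (q rho) => [|m]; case: (s rho); case: (t rho) => /=; lia.
by have := swap_diff z swap s'S t'S smax; lra.
Qed.

Lemma active_add_jobs (x : state) (s : bvec) : active (add_jobs x s) s = s.
Proof. by apply/ffunP => rho; rewrite !ffunE; case: (s rho); rewrite // addn1. Qed.

(** Let each system serve precisely the jobs that distinguish it from the other: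
    both arrive at the same state. For the system with [s] this choice is optimal
    by the bound one step earlier, so the rewards decide. *)
Lemma value_swap_bound (n : nat) : swap_bound n.
Proof.
elim: n => [|n IH] x s t sS tS smax.
  by rewrite !add0r smax weight_le_r_max.
have rs u : reward c (add_jobs x u) u = weight c u.
  by rewrite reward_active active_add_jobs.
have -> : V n.+1 (add_jobs x s) = Q n (add_jobs x s) s.
  apply/eqP; rewrite eq_le le_sched_max // andbT valueS.
  have [u uS ->] := sched_max_attained (Q n (add_jobs x s)).
  by apply: optimal_of_swap_bound => //; rewrite rs.
have := le_sched_max (Q n (add_jobs x t)) tS; rewrite -valueS.
have : EV n (add_jobs x s) s = EV n (add_jobs x t) t.
  by rewrite /EV; under eq_fun do rewrite next_state_served;
     under [in RHS]eq_fun do rewrite next_state_served.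
rewrite !QE !rs => ->; lra.
Qed.

End ValueIteration.

Theorem theorem2 (R : realType) (d : measure_display) (T : measurableType d)
    (P : probability T R) (A : T -> state) (c : queue -> R) (beta : R)
    (mA : forall rho : queue, measurable_fun setT (fun w : T => A w rho))
    (indepA : independent_coordinates P A)
    (load_out : forall j : 'I_2,
       (\sum_(i < 2) mean_arrivals P A (i, j) < 1)%E)
    (load_in : forall i : 'I_2,
       (\sum_(j < 2) mean_arrivals P A (i, j) < 1)%E)
    (c_ge0 : forall rho : queue, 0 <= c rho)
    (beta_gt0 : 0 < beta) (beta_lt1 : beta < 1)
    (q : state) (s : bvec)
    (q_interior : interior_point c q)
    (s_schedule : s \in schedules)
    (s_rmax : reward c q s = r_max c) (n : nat) :
  action_value P A c beta (value P A c beta n) q s =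
  sched_max (action_value P A c beta (value P A c beta n) q).
Proof.
have swap := value_swap_bound P mA c_ge0 beta_gt0 beta_lt1.
apply/eqP; rewrite eq_le le_sched_max //=.
have [t tS ->] :=
  sched_max_attained (action_value P A c beta (value P A c beta n) q).
exact: (optimal_of_swap_bound mA c_ge0 beta_gt0 beta_lt1 (swap n)).
Qed.
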